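(* Let $(X,\|\cdot\|)$ be a real uniformly convex and uniformly smooth Banach space and let $r>0$. Let $r\mathbb{B}=\{x\in X:\|x\|\le r\}$, let $r\mathbb{B}^{o}$ be its interior, and let $r\mathbb{S}=\{x\in X:\|x\|=r\}$. The metric projection $P_{r\mathbb{B}}:X\to r\mathbb{B}$ has the following differentiability properties. (i) $P_{r\mathbb{B}}$ is strictly Fréchet differentiable on $r\mathbb{B}^{o}$, with $\nabla P_{r\mathbb{B}}(\bar{x})=I_X$ for every $\bar{x}\in r\mathbb{B}^{o}$; that is, $\nabla P_{r\mathbb{B}}(\bar{x})(x)=x$ for every $x\in X$. (ii) $P_{r\mathbb{B}}$ is Fréchet differentiable at every $\bar{x}\in X\setminus r\mathbb{B}$, and its Fréchet derivative at $\bar{x}$ satisfies $$\nabla P_{r\mathbb{B}}(\bar{x})(x)=\frac{r}{\|\bar{x}\|}\left(x-\frac{\langle J(\bar{x}),x\rangle}{\|\bar{x}\|^2}\bar{x}\right)\quad\text{for every }x\in X.$$ In particular, (a) $\nabla P_{r\mathbb{B}}(\bar{x})(x)=\frac{r}{\|\bar{x}\|}x$ for every $x\in X$ with $\langle J(\bar{x}),x\rangle=0$; and (b) $\nabla P_{r\mathbb{B}}(\bar{x})(\bar{x})=\theta$. (iii) On the sphere $r\mathbb{S}$: (I) $P_{r\mathbb{B}}$ is Gâteaux directionally differentiable on $r\mathbb{S}$, and for every $\bar{x}\in r\mathbb{S}$: (a) $P'_{r\mathbb{B}}(\bar{x})(w)=w-\frac{1}{r^2}\langle J(\bar{x}),w\rangle\bar{x}$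 if $w\in\bar{x}_r^{\uparrow}$; (b) $P'_{r\mathbb{B}}(\bar{x})(\bar{x})=\theta$; (c) $P'_{r\mathbb{B}}(\bar{x})(w)=w$ if $w\in\bar{x}_r^{\downarrow}$. (II) $P_{r\mathbb{B}}$ is not Fréchet differentiable at any point $\bar{x}\in r\mathbb{S}$.
   Context: $\theta$ is the origin of $X$, $X^*$ is the topological dual of $X$ with norm $\|\cdot\|_*$, $\langle\cdot,\cdot\rangle$ is the pairing between $X^*$ and $X$, and $I_X$ is the identity map of $X$. The normalized duality mapping $J:X\to X^*$ sends $x$ to the unique $J(x)\in X^*$ with $\langle J(x),x\rangle=\|x\|^2=\|J(x)\|_*^2$. For a nonempty closed convex $C\subseteq X$, the metric projection $P_C:X\to C$ sends $x$ to the unique point $P_Cx\in C$ with $\|x-P_Cx\|\le\|x-z\|$ for all $z\in C$. Differentiability notions: - Gâteaux directional derivative at $x$ along $v\ne\theta$: $P'_C(x)(v)=\lim_{t\downarrow 0}\frac{P_C(x+tv)-P_C(x)}{t}$, when this limit exists. $P_C$ is Gâteaux directionally differentiable at $x$ if this exists for every $v\neq\theta$. - $P_C$ is Fréchet differentiable at $\bar{x}$ if there is a continuous linear map $\nabla P_C(\bar{x}):X\to X$ with $\lim_{x\to\bar{x}}\frac{P_C(x)-P_C(\bar{x})-\nabla P_C(\bar{x})(x-\bar{x})}{\|x-\bar{x}\|}=\theta$. - $P_C$ is strictly Fréchet differentiable at $\bar{x}$ if there is a continuous linear map $\nabla P_C(\bar{x}):X\to X$ with $\lim_{(u,v)\to(\bar{x},\bar{x})}\frac{P_C(u)-P_C(v)-\nabla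 P_C(\bar{x})(u-v)}{\|u-v\|}=\theta$ (over $u\neq v$). For $x\in r\mathbb{S}$: $x_r^{\uparrow}=\{v\in X\setminus\{\theta\}:\exists\,\delta>0,\ \|x+tv\|>r\ \text{for all }t\in(0,\delta)\}$ and $x_r^{\downarrow}=\{v\in X\setminus\{\theta\}:\exists\,\delta>0,\ \|x+tv\|\le r\ \text{for all }t\in(0,\delta)\}$. *)

(* Defs.v *)
From HB Require Import structures.
From mathcomp Require Import all_boot all_order all_algebra.
From mathcomp Require Import all_classical all_reals all_analysis.

Set Implicit Arguments.
Unset Strict Implicit.
Unset Printing Implicit Defensive.

Import Order.TTheory GRing.Theory Num.Theory.
Import numFieldNormedType.Exports.

Local Open Scope classical_set_scope.
Local Open Scope ring_scope.

Section BanachGeometry.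
Context {R : realType} (X : normedModType R).

Definition uniformly_convex :=
  forall e : R, 0 < e <= 2 -> exists2 d : R, 0 < d &
    forall x y : X, `|x| = 1 -> `|y| = 1 -> e <= `|x - y| ->
      `|2^-1 *: (x + y)| <= 1 - d.

Definition uniformly_smooth :=
  forall e : R, 0 < e -> exists2 d : R, 0 < d &
    forall x y : X, `|x| = 1 -> `|y| <= d ->
      `|x + y| + `|x - y| <= 2 + e * `|y|.

(* The elements of the topological dual are the continuous [f : {scalar X}];
   the pairing is function application. *)
Definition dual_norm (f : {scalar X}) : R :=
  sup [set `|f x| | x in [set x : X | `|x| <= 1]].

Definition duality_set (x : X) : set {scalar X} :=
  [set f : {scalar X} | [/\ continuous (f : X -> R), f x = `|x| ^+ 2
             & dual_norm f ^+ 2 = `|x| ^+ 2]].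

(* [duality_set x] is a singleton when [X] is uniformly smooth; the default
   value [\0] is only returned if it is empty. *)
Definition duality_map (x : X) : {scalar X} :=
  xget (\0 : {scalar X}) (duality_set x).

(* The nearest point exists and is unique for [C] nonempty, closed and convex
   in a uniformly convex Banach space; the default value [0] is only returned
   if there is none. *)
Definition metric_proj (C : set X) (x : X) : X :=
  xget 0 [set y | C y /\ forall z, C z -> `|x - y| <= `|x - z|].

Definition cball (r : R) : set X := [set x | `|x| <= r].

Definition sphere (r : R) : set X := [set x | `|x| = r].

Definition up_dir (r : R) (x : X) : set X :=
  [set v | v != 0 /\ exists2 d : R, 0 < d &
    forall t : R, 0 < t < d -> r < `|x + t *: v|].

Definition down_dir (r : R) (x : X) : set X :=
  [set v | v != 0 /\ exists2 d : R, 0 < d &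
    forall t : R, 0 < t < d -> `|x + t *: v| <= r].

Definition gateaux_filter (f : X -> X) (x v : X) : set_system X :=
  t^-1 *: (f (x + t *: v) - f x) @[t --> (0 : R)^'+].

Definition gateaux_differentiable (f : X -> X) (x : X) :=
  forall v : X, v != 0 -> cvg (gateaux_filter f x v).

Definition gateaux_deriv (f : X -> X) (x v : X) : X :=
  lim (gateaux_filter f x v).

(* Here [L] is the strict Frechet derivative of [f] at [x]. *)
Definition strict_diff (f : X -> X) (x : X) (L : {linear X -> X}) :=
  continuous L /\
  `|p.1 - p.2|^-1 *: (f p.1 - f p.2 - L (p.1 - p.2))
    @[p --> within [set p : X * X | p.1 != p.2] (nbhs (x, x))] --> (0 : X).

End BanachGeometry.

(* Main.v *)
Require Import Defs.
From HB Require Import structures.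
From mathcomp Require Import all_boot all_order all_algebra.
From mathcomp Require Import all_classical all_reals all_analysis.
From mathcomp Require Import ring lra.

Set Implicit Arguments.
Unset Strict Implicit.
Unset Printing Implicit Defensive.

Import Order.TTheory GRing.Theory Num.Theory.
Import numFieldNormedType.Exports.

Local Open Scope classical_set_scope.
Local Open Scope ring_scope.

(* In a uniformly convex space the projection on the ball of radius r is the
   identity inside the ball and the radial map y |-> (r / |y|) y outside.
   Uniform smoothness makes the one-sided directional derivative of the norm at
   x <> 0 linear; multiplied by |x| it is an element of the duality set of x,
   which replaces the Hahn-Banach theorem.  Hence the norm is Frechet
   differentiable at x with derivative J(x) / |x|, and the chain rule gives the
   derivative of the radial map.  At a point x of the sphere every direction
   either leaves the ball at once or stays in it for a while, so directional
   derivatives are those of the radial map or of the identity; they are 0 along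
   x and - x along - x, which rules out a linear derivative. *)

(** * One-sided directional derivatives of the norm *)

(** Rescaling by [|x|^-1] reduces to the unit sphere; the radius [d] becomes [d * |x|]. *)
Lemma uniformly_smooth_at (R : realType) (X : normedModType R) :
  uniformly_smooth X -> forall (x : X) (e : R), x != 0 -> 0 < e ->
  exists2 d : R, 0 < d &
    forall y : X, `|y| <= d -> `|x + y| + `|x - y| <= 2 * `|x| + e * `|y|.
Proof.
move=> smooth x e x_neq0 e_gt0; have nx_gt0 : 0 < `|x| by rewrite normr_gt0.
have [d d_gt0 dP] := smooth e e_gt0.
exists (d * `|x|) => [|y y_le]; first exact: mulr_gt0.
have := dP (`|x|^-1 *: x) (`|x|^-1 *: y).
rewrite -scalerDr -scalerBr !normrZ normfV normr_id mulVf ?gt_eqF//.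
rewrite -mulrDr ler_pdivrMl// => /(_ erefl); rewrite ler_pdivrMl// mulrC.
move=> /(_ y_le) /le_trans; apply.
by rewrite mulrDr mulrCA mulVKf ?gt_eqF// mulrC.
Qed.

(* The difference quotients of the norm are nondecreasing in [t] by convexity,
   so this is the one-sided directional derivative of the norm at [x]. *)
Definition norm_slope (R : realType) (X : normedModType R) (x v : X) : R :=
  inf [set (`|x + t *: v| - `|x|) / t | t in [set t : R | 0 < t]].

Lemma norm_slope_set_neq0 (R : realType) (X : normedModType R) (x v : X) :
  [set (`|x + t *: v| - `|x|) / t | t in [set t : R | 0 < t]] !=set0.
Proof. by exists ((`|x + 1 *: v| - `|x|) / 1); exists 1 => /=. Qed.

Lemma norm_slope_ge (R : realType) (X : normedModType R) (x v : X) (m : R) :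
  (forall t, 0 < t -> m <= (`|x + t *: v| - `|x|) / t) ->
  m <= norm_slope x v.
Proof.
move=> mP; apply: lb_le_inf; first exact: norm_slope_set_neq0.
by move=> _ [t t_gt0 <-]; exact: mP.
Qed.

(** This lower bound, a reverse triangle inequality, makes the infimum in [norm_slope] a genuine
    one. *)
Lemma norm_quotient_geN (R : realType) (X : normedModType R) (x v : X) (t : R) :
  0 < t -> - `|v| <= (`|x + t *: v| - `|x|) / t.
Proof.
move=> t_gt0; rewrite ler_pdivlMr// mulNr lerNl opprB lerBlDr.
have -> : `|v| * t = `|t *: v| by rewrite normrZ gtr0_norm// mulrC.
by rewrite addrC -{1}(addrK (t *: v) x) ler_normB.
Qed.

Lemma norm_slope_le (R : realType) (X : normedModType R) (x v : X) (t : R) :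
  0 < t -> norm_slope x v <= (`|x + t *: v| - `|x|) / t.
Proof.
move=> t_gt0; apply: ge_inf; last by exists t.
by exists (- `|v|) => _ [s s_gt0 <-]; exact: norm_quotient_geN.
Qed.

Lemma norm_slope_le_norm (R : realType) (X : normedModType R) (x v : X) :
  norm_slope x v <= `|v|.
Proof.
apply: (le_trans (norm_slope_le x v ltr01)).
by rewrite scale1r divr1 lerBlDl ler_normD.
Qed.

Lemma norm_slope_geN (R : realType) (X : normedModType R) (x v : X) :
  - `|v| <= norm_slope x v.
Proof. by apply: norm_slope_ge => t; exact: norm_quotient_geN. Qed.

Lemma norm_slope0 (R : realType) (X : normedModType R) (x : X) :
  norm_slope x 0 = 0.
Proof.
by apply/eqP; rewrite -normr_eq0 eq_le normr_ge0 andbT ler_norml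
  -(normr0 X) norm_slope_le_norm norm_slope_geN.
Qed.

Lemma norm_slope_id (R : realType) (X : normedModType R) (x : X) :
  norm_slope x x = `|x|.
Proof.
apply/eqP; rewrite eq_le norm_slope_le_norm; apply: norm_slope_ge => t t_gt0.
rewrite -[x in `|x + _|]scale1r -scalerDl normrZ gtr0_norm ?addr_gt0//.
suff -> : ((1 + t) * `|x| - `|x|) / t = `|x| by [].
by field; rewrite gt_eqF.
Qed.

(* With [tau = s * t / (s + t)], the point [x + tau (u + v)] is the convex
   combination of [x + s u] and [x + t v] with weights [t] and [s]. *)
Lemma norm_slope_subadd (R : realType) (X : normedModType R) (x u v : X) :
  norm_slope x (u + v) <= norm_slope x u + norm_slope x v.
Proof.
rewrite -lerBlDr; apply: norm_slope_ge => s s_gt0.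
rewrite lerBlDr -lerBlDl; apply: norm_slope_ge => t t_gt0.
rewrite lerBlDl; have st_gt0 : 0 < s + t by exact: addr_gt0.
pose tau := s * t / (s + t).
have tau_gt0 : 0 < tau by rewrite divr_gt0// mulr_gt0.
apply: (le_trans (norm_slope_le _ _ tau_gt0)).
have -> : (`|x + s *: u| - `|x|) / s + (`|x + t *: v| - `|x|) / t =
    ((t / (s + t)) * `|x + s *: u| + (s / (s + t)) * `|x + t *: v| - `|x|)
    / tau.
  by rewrite /tau; field; rewrite !gt_eqF.
rewrite ler_pM2r ?invr_gt0// lerD2r.
have -> : x + tau *: (u + v) =
    (t / (s + t)) *: (x + s *: u) + (s / (s + t)) *: (x + t *: v).
  rewrite !scalerDr !scalerA addrACA -scalerDl -mulrDl.
  rewrite addrC (addrC t) divff ?gt_eqF//.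
  rewrite scale1r addrC; congr (_ + (_ *: _ + _ *: _)); rewrite /tau; ring.
rewrite (le_trans (ler_normD _ _))// !normrZ normfV.
by rewrite (gtr0_norm s_gt0) (gtr0_norm t_gt0) (gtr0_norm st_gt0).
Qed.

(** Replacing the step [t] by [t * b] gives one inequality; the same inequality for [a^-1] gives the
    other. *)
Lemma norm_slopeZ_gt0 (R : realType) (X : normedModType R) (x v : X) (a : R) :
  0 < a -> norm_slope x (a *: v) = a * norm_slope x v.
Proof.
have le_slope (b : R) (w : X) : 0 < b ->
    b * norm_slope x w <= norm_slope x (b *: w).
  move=> b_gt0; apply: norm_slope_ge => t t_gt0.
  have := norm_slope_le x w (mulr_gt0 t_gt0 b_gt0).
  rewrite -(ler_pM2l b_gt0) scalerA => /le_trans; apply.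
  have cancelb (y : R) : b * (y / (t * b)) = y / t.
    by field; rewrite !gt_eqF.
  by rewrite cancelb.
move=> a_gt0; apply/eqP; rewrite eq_le le_slope// andbT.
have := le_slope a^-1 (a *: v); rewrite invr_gt0 => /(_ a_gt0).
by rewrite scalerA mulVf ?gt_eqF// scale1r ler_pdivrMl.
Qed.

(** Subadditivity makes the sum of the two slopes nonnegative; smoothness bounds it by every
    [e > 0]. *)
Lemma norm_slopeN (R : realType) (X : normedModType R) (x v : X) :
  uniformly_smooth X -> x != 0 -> norm_slope x (- v) = - norm_slope x v.
Proof.
move=> smooth x_neq0.
have : 0 <= norm_slope x v + norm_slope x (- v).
  by rewrite -(norm_slope0 x) -(subrr v) norm_slope_subadd.
suff : norm_slope x v + norm_slope x (- v) <= 0 by lra.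
apply/ler_addgt0Pr => e e_gt0; rewrite add0r.
have [->|v_neq0] := eqVneq v 0.
  by rewrite oppr0 norm_slope0 addr0 ltW.
have nv_gt0 : 0 < `|v| by rewrite normr_gt0.
(* With tolerance [e / |v|] and step [d / |v|], the increment has norm [d] and the error is
   [e * (d / |v|)], which is [e] after division by the step. *)
have [d d_gt0 dP] := uniformly_smooth_at smooth x_neq0 (divr_gt0 e_gt0 nv_gt0).
have t_gt0 : 0 < d / `|v| by exact: divr_gt0.
have slopes_le := lerD (norm_slope_le x v t_gt0) (norm_slope_le x (- v) t_gt0).
apply: (le_trans slopes_le).
rewrite -mulrDl ler_pdivrMr// scalerN.
have := dP ((d / `|v|) *: v); rewrite normrZ (gtr0_norm t_gt0).
rewrite divfK ?gt_eqF// -mulrA (mulrC _^-1) => /(_ (lexx d)).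
lra.
Qed.

(** Oddness extends homogeneity to negative scalars and turns subadditivity at opposite vectors into
    superadditivity. *)
Lemma norm_slope_is_scalar (R : realType) (X : normedModType R) (x : X) :
  uniformly_smooth X -> x != 0 -> scalar (norm_slope x).
Proof.
move=> smooth x_neq0; have slopeN v := norm_slopeN v smooth x_neq0.
have slopeZ a v : norm_slope x (a *: v) = a * norm_slope x v.
  have [a_gt0|a_lt0|<-] := ltgtP 0 a; first exact: norm_slopeZ_gt0.
    by rewrite -[a]opprK scaleNr slopeN norm_slopeZ_gt0 ?oppr_gt0// !mulNr.
  by rewrite scale0r norm_slope0 mul0r.
move=> a u v; rewrite -slopeZ; apply/eqP; rewrite eq_le norm_slope_subadd /=.
rewrite -lerN2 opprD -!slopeN opprD; exact: norm_slope_subadd.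
Qed.

(** * The dual norm and the duality map *)

Lemma ler_dual_norm (R : realType) (X : normedModType R) (f : {scalar X})
    (v : X) :
  continuous (f : X -> R) -> `|f v| <= dual_norm f * `|v|.
Proof.
move=> /(_ 0) /(continuous_linear_bounded 0) /linear_boundedP.
move=> /pinfty_ex_gt0[M M_gt0 fM].
have [->|v_neq0] := eqVneq v 0; first by rewrite linear0 !normr0 mulr0.
have nv_gt0 : 0 < `|v| by rewrite normr_gt0.
rewrite -ler_pdivrMr//; apply: ub_le_sup.
  exists M => _ [w /= w_le1 <-]; apply: (le_trans (fM w)).
  by rewrite -[leRHS]mulr1 ler_pM2l.
exists (`|v|^-1 *: v); first by rewrite /= normrZ normfV normr_id mulVf ?gt_eqF.
by rewrite linearZ /= normrM normfV normr_id mulrC.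
Qed.

Lemma duality_set_neq0 (R : realType) (X : normedModType R) (x : X) :
  uniformly_smooth X -> x != 0 -> duality_set x !=set0.
Proof.
move=> smooth x_neq0; have nx_gt0 : 0 < `|x| by rewrite normr_gt0.
pose g v : R := `|x| * norm_slope x v.
have g_scalar : scalar g.
  move=> a u v; rewrite /g (norm_slope_is_scalar smooth x_neq0) mulrDr.
  by rewrite mulrCA.
pose gM := GRing.isLinear.Build _ _ _ _ _ g_scalar.
pose f : {scalar X} := HB.pack g gM.
have f_le v : `|f v| <= `|x| * `|v|.
  rewrite normrM normr_id ler_pM2l// ler_norml norm_slope_geN.
  exact: norm_slope_le_norm.
have f_id : f x = `|x| ^+ 2 by rewrite expr2 -{2}(norm_slope_id x).
have f_cont : continuous (f : X -> R).
  apply: bounded_linear_continuous; apply/linear_boundedP.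
  exists `|x|; split; first exact: num_real.
  by move=> M /ltW M_ge v; apply: (le_trans (f_le v)); exact: ler_wpM2r.
exists f; split => //; congr (_ ^+ 2); apply/eqP; rewrite eq_le.
(* Evaluation at [x] gives [|x| <= dual_norm f]; the bound [f_le] gives the converse. *)
apply/andP; split; last first.
  have := ler_dual_norm x f_cont.
  by rewrite f_id ger0_norm ?exprn_ge0// expr2 ler_pM2r.
apply: ge_sup; first by exists `|f 0|; exists 0 => //=; rewrite normr0.
move=> _ [v /= v_le1 <-]; apply: (le_trans (f_le v)).
by rewrite -[leRHS]mulr1 ler_pM2l.
Qed.

Lemma duality_mapP (R : realType) (X : normedModType R) (x : X) :
  uniformly_smooth X -> x != 0 ->
  [/\ continuous (duality_map x : X -> R), duality_map x x = `|x| ^+ 2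
    & forall v, `|duality_map x v| <= `|x| * `|v|].
Proof.
move=> smooth x_neq0; have [f_cont f_id f_norm] :=
  @xgetPex _ (\0 : {scalar X}) _ (duality_set_neq0 smooth x_neq0).
split => // v; apply: (le_trans (ler_dual_norm v f_cont)).
(* Nonnegativity allows the squares to be cancelled, so the dual norm equals [|x|]. *)
have dn_ge0 : 0 <= dual_norm (duality_map x).
  rewrite -(pmulr_lge0 _ (_ : 0 < `|x|)) ?normr_gt0//.
  exact: le_trans (normr_ge0 _) (ler_dual_norm x f_cont).
move/eqP: f_norm; rewrite eqrXn2// => /eqP f_norm.
by rewrite f_norm.
Qed.

(** * Fréchet derivatives of the norm and of the radial map *)

(* [J x / |x|] is a subgradient of the norm at [x]; smoothness bounds the
   subgradient inequalities at [x + v] and [x - v] against each other. *)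
Lemma norm_expansion (R : realType) (X : normedModType R) (x : X) (e : R) :
  uniformly_smooth X -> x != 0 -> 0 < e ->
  \forall v \near (0 : X),
    `| `|x + v| - `|x| - `|x|^-1 * duality_map x v| <= e * `|v|.
Proof.
move=> smooth x_neq0 e_gt0; have nx_gt0 : 0 < `|x| by rewrite normr_gt0.
have [_ J_id J_le] := duality_mapP smooth x_neq0.
(* This is [J x (x + v) <= |x| * |x + v|] combined with [J x x = |x| ^+ 2]. *)
have subgradient v : `|x|^-1 * duality_map x v <= `|x + v| - `|x|.
  rewrite ler_pdivrMl// mulrBr lerBrDr -expr2 -J_id addrC -linearD.
  exact: le_trans (ler_norm _) (J_le _).
have [d d_gt0 dP] := uniformly_smooth_at smooth x_neq0 e_gt0.
apply/nbhs_norm0P; exists d => //= v /= /ltW /dP smooth_v.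
have := subgradient v; have := subgradient (- v).
rewrite linearN mulrN => subN sub; rewrite ger0_norm ?subr_ge0//; lra.
Qed.

Lemma is_diff_norm (R : realType) (X : normedModType R) (x : X) :
  uniformly_smooth X -> x != 0 ->
  is_diff x (fun y : X => `|y| : R) (fun v => `|x|^-1 * duality_map x v).
Proof.
move=> smooth x_neq0; have [J_cont _ _] := duality_mapP smooth x_neq0.
pose L : {linear X -> R} :=
  `|x|^-1 \*: (duality_map x : {linear X -> R}).
have L_cont : continuous L.
  by move=> v; apply: cvgMr; exact: J_cont.
have L_expansion : (fun y : X => `|y| : R) \o shift x =
    cst `|x| + L +o_ (0 : X) id.
  apply/eqaddoP => e e_gt0; near=> v.
  have : `| `|x + v| - `|x| - `|x|^-1 * duality_map x v| <= e * `|v|.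
    by near: v; exact: norm_expansion.
  rewrite !fctE /=.
  by rewrite opprD addrA (addrC v).
(* Uniqueness identifies ['d] with [L]; the expansion then yields differentiability itself. *)
have dL := diff_unique L_cont L_expansion.
by apply: DiffDef => //; apply/diff_locallyP; rewrite dL.
Unshelve. all: by end_near. Qed.

(** The product rule, as the chain rule for the continuous bilinear map sending [(a, w)] to
    [a *: w]. *)
Lemma is_diff_scale (R : realType) (V W : normedModType R) (k dk : V -> R)
    (f df : V -> W) (x : V) :
  is_diff x k dk -> is_diff x f df ->
  is_diff x (fun y => k y *: f y) (fun v => k x *: df v + dk v *: f x).
Proof.
move=> kP fP.
have scale_bilinear : bilinear_for
    (GRing.Scale.Law.clone _ _ *:%R _) (GRing.Scale.Law.clone _ _ *:%R _)
    (fun (a : R) (w : W) => a *: w).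
  split=> [w|b] a u v /=; first by rewrite scalerDl scalerA.
  by rewrite scalerDr !scalerA mulrC.
pose scaleM := bilinear_isBilinear.Build R R W W _ _ _ scale_bilinear.
pose B : {bilinear R -> W -> W} :=
  HB.pack (fun (a : R) (w : W) => a *: w) scaleM.
have B_cont : continuous (fun p : R * W => B p.1 p.2).
  exact: scale_continuous.
have BP : is_diff (k x, f x) (fun p : R * W => p.1 *: p.2)
    (fun q => k x *: q.2 + q.1 *: f x).
  by apply: DiffDef; [exact: (differentiable_bilin (f:=B))
                     |exact: (diff_bilin (f:=B) (k x, f x) B_cont)].
exact: (is_diff_comp (is_diff_pair kP fP) BP).
Qed.

(** The first-order expansion depends only on the germ at [x]; this carries the derivative of the
    radial map over to the projection. *)
Lemma near_eq_is_diff (R : realType) (V W : normedModType R) (f g dg : V -> W)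
    (x : V) :
  (\forall y \near x, f y = g y) -> is_diff x g dg -> is_diff x f dg.
Proof.
move=> fg gP; have g_diff : differentiable g x by exact: ex_diff.
have [dg_cont /eqaddoP g_expansion] := (diff_locallyP x g).1 g_diff.
have f_expansion : f \o shift x = cst (f x) + 'd g x +o_ (0 : V) id.
  apply/eqaddoP => e e_gt0; have g_le := g_expansion e e_gt0.
  have /nbhs0P fg0 := fg.
  near=> h; rewrite !fctE /= (nbhs_singleton fg).
  have -> : f (h + x) = g (h + x) by rewrite addrC; near: h.
  by near: h.
have df := diff_unique dg_cont f_expansion.
apply: DiffDef; last by rewrite df diff_val.
by apply/diff_locallyP; rewrite df.
Unshelve. all: by end_near. Qed.

(** The two-sided limit of difference quotients along [v] restricts to [t > 0]. *)
Lemma is_diff_gateaux (R : realType) (X : normedModType R) (f df : X -> X)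
    (x v : X) :
  is_diff x f df -> gateaux_filter f x v --> df v.
Proof.
move=> fP; have f_diff : differentiable f x by exact: ex_diff.
have : t^-1 *: (f (t *: v + x) - f x) @[t --> (0 : R)^'] --> df v.
  rewrite -(diff_val (is_diff_def := fP)) -deriveE//.
  exact: (diff_derivable f_diff).
have swap (t : R) : t^-1 *: (f (x + t *: v) - f x) =
    t^-1 *: (f (t *: v + x) - f x) by rewrite (addrC x).
rewrite /gateaux_filter (funext swap); apply: cvg_trans.
by apply: cvg_app; apply: within_subset => t /=; rewrite lt0r => /andP[].
Qed.

Lemma is_diff_radial (R : realType) (X : normedModType R) (r : R) (x : X) :
  uniformly_smooth X -> x != 0 ->
  is_diff x (fun y : X => (r / `|y|) *: y)
    (fun v => (r / `|x|) *: (v - (duality_map x v / `|x| ^+ 2) *: x)).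
Proof.
move=> smooth x_neq0; have nx_neq0 : `|x| != 0 by rewrite normr_eq0.
have norm_diff := is_diff_norm smooth x_neq0.
have inv_diff : is_diff x (fun y : X => `|y|^-1)
    (fun v => - `|x| ^- 2 * (`|x|^-1 * duality_map x v)).
  apply: DiffDef; first exact: differentiableV.
  by rewrite diffV// diff_val.
have coef_diff := is_diffZ r inv_diff.
apply: is_diff_eq (is_diff_scale coef_diff (is_diff_id x)) _.
apply/funext => v /=; rewrite scalerBr !scalerA; congr (_ + _).
rewrite -scaleNr; congr (_ *: _).
rewrite -[LHS]/(r * (- `|x| ^- 2) / `|x| * duality_map x v).
by field.
Qed.

(** * The metric projection inside and outside the ball *)

Lemma metric_proj_id (R : realType) (X : normedModType R) (C : set X) (x : X) :
  C x -> metric_proj C x = x.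
Proof.
move=> Cx; apply: xget_unique => [|y [_ /(_ _ Cx)]].
  by split => // z _; rewrite subrr normr0.
by rewrite subrr normr0 normr_le0 subr_eq0 eq_sym => /eqP.
Qed.

(** The triangle inequality forces both norms to equal [D]. If the points differed, uniform
    convexity, with [e] the distance between their normalizations, would push the midpoint below
    [D]. *)
Lemma uniformly_convex_midpoint (R : realType) (X : normedModType R)
    (x y : X) (D : R) :
  uniformly_convex X -> 0 < D -> `|x| <= D -> `|y| <= D ->
  D <= `|2^-1 *: (x + y)| -> x = y.
Proof.
move=> convex D_gt0 x_le y_le mid_ge.
have norm2 : `|2^-1 : R| = 2^-1 by rewrite gtr0_norm ?invr_gt0.
have tri := ler_normD x y.
have xyD : D *+ 2 <= `|x + y|.
  by move: mid_ge; rewrite normrZ norm2 ler_pdivlMl// mulr_natl.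
have nx : `|x| = D by lra.
have ny : `|y| = D by lra.
have unit (z : X) : `|z| = D -> `|D^-1 *: z| = 1.
  by move=> nz; rewrite normrZ nz gtr0_norm ?invr_gt0// mulVf// gt_eqF.
apply/eqP/negPn/negP => xy_neq.
have e_gt0 : 0 < `|D^-1 *: x - D^-1 *: y|.
  by rewrite -scalerBr normr_gt0 scaler_eq0 invr_eq0 gt_eqF//= subr_eq0.
have e_le2 : `|D^-1 *: x - D^-1 *: y| <= 2.
  by rewrite (le_trans (ler_normB _ _))// !unit// lexx.
have [|d d_gt0 /(_ _ _ (unit x nx) (unit y ny) (lexx _))] :=
  convex `|D^-1 *: x - D^-1 *: y|; first by rewrite e_gt0.
rewrite -scalerDr scalerA mulrC -scalerA normrZ gtr0_norm ?invr_gt0//.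
rewrite ler_pdivrMl// => mid_le.
have : 0 < D * d by exact: mulr_gt0.
by move: mid_le; rewrite mulrBr mulr1; lra.
Qed.

(* The midpoint of two nearest points would be strictly nearer. *)
Lemma metric_proj_cball_out (R : realType) (X : normedModType R) (r : R)
    (x : X) :
  uniformly_convex X -> 0 < r -> r < `|x| ->
  metric_proj (cball r) x = (r / `|x|) *: x.
Proof.
move=> convex r_gt0 x_gt.
have nx_gt0 : 0 < `|x| by exact: lt_trans x_gt.
have D_gt0 : 0 < `|x| - r by rewrite subr_gt0.
have dist_ge z : cball r z -> `|x| - r <= `|x - z|.
  by move=> /= z_le; have := lerB_dist x z; rewrite /cball/= in z_le; lra.
have proj_in : cball r ((r / `|x|) *: x).
  by rewrite /cball /= normrZ normf_div normr_id divfK ?gt_eqF// gtr0_norm.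
have proj_dist : `|x - (r / `|x|) *: x| = `|x| - r.
  rewrite -{1}[x]scale1r -scalerBl normrZ.
  rewrite ger0_norm ?subr_ge0 ?ler_pdivrMr ?mul1r ?ltW//.
  by rewrite mulrBl mul1r divfK// gt_eqF.
apply: xget_unique => [|y [y_in y_min]].
  by split => // z /dist_ge; rewrite proj_dist.
have y_dist : `|x - y| <= `|x| - r by rewrite -proj_dist y_min.
(* Both differences have norm at most [|x| - r], and their midpoint is [x] minus a point of the
   ball, hence has norm at least [|x| - r]. *)
suff : x - y = x - (r / `|x|) *: x by move/addrI/oppr_inj.
apply: (uniformly_convex_midpoint convex D_gt0) => //.
  by rewrite proj_dist.
have -> : 2^-1 *: (x - y + (x - (r / `|x|) *: x)) =
    x - 2^-1 *: (y + (r / `|x|) *: x).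
  rewrite addrACA -opprD scalerBr; congr (_ - _).
  by rewrite -mulr2n -[x *+ 2]scaler_nat scalerA mulVf ?scale1r// pnatr_eq0.
apply: dist_ge; rewrite /cball /= normrZ gtr0_norm ?invr_gt0//.
rewrite ler_pdivrMl// (le_trans (ler_normD _ _))//.
by rewrite /cball /= in y_in proj_in; lra.
Qed.

Lemma is_diff_metric_proj_cball_out (R : realType) (X : normedModType R)
    (r : R) (x : X) :
  uniformly_convex X -> uniformly_smooth X -> 0 < r -> r < `|x| ->
  is_diff x (metric_proj (cball r))
    (fun v => (r / `|x|) *: (v - (duality_map x v / `|x| ^+ 2) *: x)).
Proof.
move=> convex smooth r_gt0 x_gt.
apply: near_eq_is_diff (is_diff_radial r smooth _); last first.
  by rewrite -normr_gt0 (lt_trans r_gt0).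
near=> y; apply: metric_proj_cball_out => //.
near: y; have : `|y| @[y --> x] --> `|x| by apply: cvg_norm; exact: cvg_id.
by move=> /cvgr_gt; apply.
Unshelve. all: by end_near. Qed.

(** Near [(x, x)] both points lie in [C], where the projection is the identity, so the quotient is 0
    there. *)
Lemma strict_diff_metric_proj_interior (R : realType) (X : normedModType R)
    (C : set X) (x : X) :
  C^° x -> strict_diff (metric_proj C) x idfun.
Proof.
move=> Cx; split; first by move=> y; exact: cvg_id.
apply: cvg_near_cst; apply: cvg_within.
have : \forall p \near (x, x), C p.1 /\ C p.2.
  by exists (C, C) => // -[y z] [].
apply: filterS => -[y z] /= [Cy Cz].
by rewrite !metric_proj_id// subrr scaler0.
Qed.

(** * Directional derivatives on the sphere *)

Lemma gateaux_metric_proj_down (R : realType) (X : normedModType R) (r : R)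
    (x w : X) :
  `|x| <= r -> down_dir r x w ->
  gateaux_filter (metric_proj (cball r)) x w --> w.
Proof.
move=> x_le [_ [d d_gt0 dP]]; apply: cvg_near_cst.
near=> t; have t_gt0 : 0 < t by [].
rewrite !metric_proj_id//; last first.
  by apply: dP; rewrite t_gt0 /=; near: t; exact: nbhs_right_lt.
by rewrite addrC addKr scalerA mulVf ?scale1r// gt_eqF.
Unshelve. all: by end_near. Qed.

(** The radial map fixes [x] since [r / |x| = 1], and it agrees with the projection at [x + t *: w]
    for small [t > 0]; the two right derivatives along [w] therefore coincide. *)
Lemma gateaux_metric_proj_up (R : realType) (X : normedModType R) (r : R)
    (x w : X) :
  uniformly_convex X -> uniformly_smooth X -> 0 < r ->
  sphere r x -> up_dir r x w ->
  gateaux_filter (metric_proj (cball r)) x w -->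
    w - ((r ^+ 2)^-1 * duality_map x w) *: x.
Proof.
move=> convex smooth r_gt0 x_sphere [_ [d d_gt0 dP]].
rewrite /sphere /= in x_sphere.
have x_neq0 : x != 0 by rewrite -normr_gt0 x_sphere.
have := is_diff_gateaux (v := w) (is_diff_radial r smooth x_neq0).
rewrite x_sphere divff ?gt_eqF// scale1r [_ / r ^+ 2]mulrC.
apply: cvg_trans; apply: near_eq_cvg.
near=> t; have t_gt0 : 0 < t by [].
have xtw_out : r < `|x + t *: w|.
  by apply: dP; rewrite t_gt0 /=; near: t; exact: nbhs_right_lt.
rewrite (metric_proj_cball_out convex r_gt0 xtw_out) metric_proj_id//.
  by rewrite x_sphere divff ?gt_eqF// scale1r.
by rewrite /cball /= x_sphere.
Unshelve. all: by end_near. Qed.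

(* By convexity of the ball, one point of the ball on the open ray from [x]
   along [v] puts the whole segment up to it in the ball. *)
Lemma up_or_down_dir (R : realType) (X : normedModType R) (r : R) (x v : X) :
  `|x| <= r -> v != 0 -> up_dir r x v \/ down_dir r x v.
Proof.
move=> x_le v_neq0.
have [[s [s_gt0 s_le]]|no_s] :=
  pselect (exists s : R, 0 < s /\ `|x + s *: v| <= r); last first.
  left; split => //; exists 1 => // t /andP[t_gt0 _]; rewrite ltNge.
  by apply/negP => t_le; apply: no_s; exists t.
right; split => //; exists s => // t /andP[t_gt0 t_lt].
have -> : x + t *: v = (1 - t / s) *: x + (t / s) *: (x + s *: v).
  by rewrite scalerDr scalerA divfK ?gt_eqF// addrA -scalerDl subrK scale1r.
have c_ge0 : 0 <= t / s by rewrite divr_ge0// ltW.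
have c_le1 : 0 <= 1 - t / s by rewrite subr_ge0 ler_pdivrMr// mul1r ltW.
rewrite (le_trans (ler_normD _ _))// !(normrZ _ (_ : X)) !ger0_norm//.
rewrite -[r](_ : (1 - t / s) * r + t / s * r = r).
  by rewrite lerD// ler_wpM2l.
by rewrite -mulrDl subrK mul1r.
Qed.

Lemma up_dir_self (R : realType) (X : normedModType R) (r : R) (x : X) :
  0 < r -> sphere r x -> up_dir r x x.
Proof.
rewrite /sphere /= => r_gt0 x_sphere.
split; first by rewrite -normr_gt0 x_sphere.
exists 1 => // t /andP[t_gt0 _].
rewrite -[x in `|x + _|]scale1r -scalerDl normrZ gtr0_norm ?addr_gt0// x_sphere.
by rewrite ltr_pMl// ltrDl.
Qed.

Lemma down_dir_opp (R : realType) (X : normedModType R) (r : R) (x : X) :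
  0 < r -> sphere r x -> down_dir r x (- x).
Proof.
rewrite /sphere /= => r_gt0 x_sphere.
split; first by rewrite oppr_eq0 -normr_gt0 x_sphere.
exists 1 => // t /andP[t_gt0 t_lt1].
rewrite scalerN -[x in `|x - _|]scale1r -scalerBl normrZ.
rewrite gtr0_norm ?subr_gt0// x_sphere.
by apply: ler_piMl; rewrite ?gerBl ltW.
Qed.

Theorem theorem3p1 (R : realType) (X : completeNormedModType R) (r : R)
    (X_convex : uniformly_convex X) (X_smooth : uniformly_smooth X)
    (r_gt0 : 0 < r) :
  let P : X -> X := metric_proj (cball r) in
  (* (i) *)
  (forall x : X, (cball r)^° x -> strict_diff P x idfun) /\
  (* (ii) *)
  (forall x : X, (~` cball r) x ->
    [/\ differentiable P x,
        forall v : X, 'd P x v =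
          (r / `|x|) *: (v - (duality_map x v / `|x| ^+ 2) *: x),
        forall v : X, duality_map x v = 0 -> 'd P x v = (r / `|x|) *: v
      & 'd P x x = 0]) /\
  (* (iii) (I) *)
  (forall x : X, sphere r x ->
    [/\ gateaux_differentiable P x,
        forall w : X, up_dir r x w ->
          gateaux_deriv P x w = w - ((r ^+ 2)^-1 * duality_map x w) *: x,
        gateaux_deriv P x x = 0
      & forall w : X, down_dir r x w -> gateaux_deriv P x w = w]) /\
  (* (iii) (II) *)
  (forall x : X, sphere r x -> ~ differentiable P x).
Proof.
move=> P.
have neq0 (x : X) : r <= `|x| -> x != 0.
  by move=> x_ge; rewrite -normr_gt0 (lt_le_trans r_gt0).
have sphere_neq0 (x : X) : sphere r x -> x != 0.
  by move=> x_sphere; apply: neq0; rewrite x_sphere.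
have up (x w : X) : sphere r x -> up_dir r x w ->
    gateaux_deriv P x w = w - ((r ^+ 2)^-1 * duality_map x w) *: x.
  move=> x_sphere w_up; apply: cvg_lim => //.
  exact: gateaux_metric_proj_up.
have down (x w : X) : sphere r x -> down_dir r x w -> gateaux_deriv P x w = w.
  move=> x_sphere w_down; apply: cvg_lim => //.
  by apply: gateaux_metric_proj_down => //; rewrite x_sphere.
have up_self (x : X) : sphere r x -> gateaux_deriv P x x = 0.
  move=> x_sphere; rewrite up//; last exact: up_dir_self.
  have [_ -> _] := duality_mapP X_smooth (sphere_neq0 x x_sphere).
  by rewrite x_sphere mulVf ?scale1r ?subrr// expf_neq0// gt_eqF.
split; first by move=> x; exact: strict_diff_metric_proj_interior.
split; [|split].
- move=> x /negP; rewrite -ltNge => x_gt.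
  have PP := is_diff_metric_proj_cball_out X_convex X_smooth r_gt0 x_gt.
  have dP v : 'd P x v =
      (r / `|x|) *: (v - (duality_map x v / `|x| ^+ 2) *: x).
    by rewrite (diff_val (is_diff_def := PP)).
  split => //; first by move=> v Jv0; rewrite dP Jv0 mul0r scale0r subr0.
  have x_neq0 := neq0 x (ltW x_gt).
  have [_ J_id _] := duality_mapP X_smooth x_neq0.
  by rewrite dP J_id divff ?scale1r ?subrr ?scaler0// expf_neq0 ?normr_eq0.
- move=> x x_sphere; split; [|by move=> w; exact: up|exact: up_self
                            |by move=> w; exact: down].
  move=> v v_neq0.
  have x_le : `|x| <= r by rewrite x_sphere.
  have [v_up|v_down] := up_or_down_dir x_le v_neq0; apply/cvg_ex.
    by eexists; exact: gateaux_metric_proj_up.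
  by exists v; exact: gateaux_metric_proj_down.
- move=> x x_sphere P_diff.
  have deriv v : gateaux_deriv P x v = 'd P x v.
    apply: cvg_lim => //; exact: (is_diff_gateaux (differentiableP P_diff)).
  (* Linearity and the zero derivative along [x] also give the value 0 here, forcing [x = 0]. *)
  have : 'd P x (- x) = - x.
    by rewrite -deriv down//; exact: down_dir_opp.
  rewrite linearN -deriv up_self// oppr0 => /eqP.
  by rewrite eq_sym oppr_eq0; apply/negP/sphere_neq0.
Qed.
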